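(* Let $\ell\ge 4$ be an integer and let $n\ge 3(\ell+3)$ be an integer divisible by $18$. Then there exists a $C_\ell$-divisible $3$-graph $H$ on $n$ vertices which satisfies $\delta_2(H)\ge (2n-15)/3$ but does not admit a tour decomposition.
   Context: A $3$-graph is a $3$-uniform hypergraph. $\delta_2(H)$ is the minimum, over all pairs of distinct vertices, of the number of edges containing the pair. $H$ is $C_\ell$-divisible if the number of edges containing each vertex is divisible by $3$ and the total number of edges of $H$ is divisible by $\ell$. A tour in $H$ is a cyclic sequence $v_1,\dots,v_r$ of not necessarily distinct vertices such that for every $1\le i\le r$ the set $\{v_i,v_{i+1},v_{i+2}\}$ (indices modulo $r$) is an edge of $H$, and these $r$ edges are all distinct. A tour decomposition of $H$ is a collection of pairwise edge-disjoint tours in $H$ which together cover all edges of $H$. *)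

(* Defs.v *)
From mathcomp Require Import all_boot all_order all_algebra.

Set Implicit Arguments.
Unset Strict Implicit.
Unset Printing Implicit Defensive.

Section ThreeGraphs.
Variable T : finType.
Implicit Types (H : {set {set T}}) (x y : T) (s : seq T).

(* A 3-graph on the vertex set T is given by its set of edges. *)
Definition is_3graph H : Prop := forall e, e \in H -> #|e| = 3.

Definition degree H x : nat := #|[set e in H | x \in e]|.

Definition codegree H x y : nat := #|[set e in H | [set x; y] \subset e]|.

(* Codegrees in a 3-graph are less than #|T|, so the default value #|T| of the
   iterated minimum only matters when there is no pair of distinct vertices. *)
Definition delta2 H : nat :=
  \big[minn/#|T|]_(p : T * T | p.1 != p.2) codegree H p.1 p.2.

Definition Cl_divisible (l : nat) H : Prop :=
  (forall x, 3 %| degree H x) /\ l %| #|H|.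

(* ordS is the cyclic successor on 'I_(size s). *)
Definition tour_edge s (i : 'I_(size s)) : {set T} :=
  let v := tnth (in_tuple s) in [set v i; v (ordS i); v (ordS (ordS i))].

Definition is_tour H s : Prop :=
  [/\ 0 < size s, forall i, @tour_edge s i \in H & injective (@tour_edge s)].

Definition tour_edges s : {set {set T}} := [set tour_edge i | i : 'I_(size s)].

Definition tour_decomposition H (D : seq (seq T)) : Prop :=
  [/\ forall s, s \in D -> is_tour H s,
      pairwise (fun s t => [disjoint tour_edges s & tour_edges t]) D
    & forall e, e \in H -> exists2 s, s \in D & e \in tour_edges s].

End ThreeGraphs.

(* Main.v *)
(* Split the vertices into three classes of size N = n / 3 and let H0 consist of the triples
   that meet exactly two classes. Give an edge weight 1 in Z/3 if it has two vertices in class 0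
   and one in class 1, weight -1 in the opposite case, and weight 0 otherwise. Along a tour in H0
   this weight is the increment of a potential on ordered pairs of classes, so every tour, and
   hence every tour-decomposable subgraph of H0, has total weight 0. Swapping classes 0 and 1
   shows that H0 has total weight 0 too. Now remove from H0 a 12-edge gadget with all degrees
   0 or 3, codegrees at most 1 and total weight 1, together with an edge-disjoint tight cycle,
   whose length is chosen to make the number of edges left a multiple of l. All degrees stay
   divisible by 3 and every codegree drops by at most 3, but the weight left is -1. *)

Require Import Defs.
From mathcomp Require Import all_boot all_order all_algebra all_fingroup.
From mathcomp Require Import zify.

Set Implicit Arguments.
Unset Strict Implicit.
Unset Printing Implicit Defensive.

Import GRing.Theory Num.Theory.

(** * Counting degrees and codegrees in 3-graphs *)

Section Triples.
Variable T : finType.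
Implicit Types (x y z : T) (H F C : {set {set T}}).

Lemma big_set3 (R : Type) (idx : R) (op : Monoid.com_law idx) (g : T -> R) x y z :
    x != y -> y != z -> x != z ->
  \big[op/idx]_(t in [set x; y; z]) g t = op (op (g x) (g y)) (g z).
Proof.
move=> xy yz xz.
rewrite setUC big_setU1 /=; last by rewrite !inE negb_or eq_sym xz eq_sym yz.
by rewrite big_setU1 ?inE //= big_set1 Monoid.mulmC.
Qed.

Lemma cards3 x y z :
  (#|[set x; y; z]| == 3) = [&& x != y, y != z & x != z].
Proof.
case: (eqVneq x y) => [->|xy] /=.
  by rewrite setUid cards2; case: (_ != _).
case: (eqVneq y z) => [->|yz] /=.
  by rewrite -setUA setUid cards2; case: (_ != _).
case: (eqVneq x z) => [->|xz] /=.
  by rewrite setUC setUA setUid cards2; case: (_ != _).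
by rewrite -sum1_card big_set3.
Qed.

Lemma degree_sum H x : degree H x = \sum_(e in H) (x \in e).
Proof.
rewrite /degree -sum1_card big_mkcond [RHS]big_mkcond.
by apply: eq_bigr => e _; rewrite !inE; case: (e \in H); case: (x \in e).
Qed.

(* Double counting: an edge through x is counted once for each of its two other vertices. *)
Lemma sum_codegree H x : is_3graph H ->
  \sum_(y | y != x) codegree H x y = 2 * degree H x.
Proof.
move=> H3.
have codE y : codegree H x y = \sum_(e in H) ((x \in e) && (y \in e)).
  rewrite /codegree -sum1_card big_mkcond [RHS]big_mkcond.
  apply: eq_bigr => e _; rewrite !inE subUset !sub1set.
  by case: (e \in H); case: (x \in e); case: (y \in e).
rewrite (eq_bigr _ (fun y _ => codE y)) exchange_big /= degree_sum big_distrr /=.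
apply: eq_bigr => e /H3 e3.
case: (boolP (x \in e)) => xe /=; last by rewrite big1.
rewrite -big_mkcondr /= sum1_card muln1.
have -> : 2 = #|e :\ x| by move: e3; rewrite (cardsD1 x) xe; lia.
by apply: eq_card => y; rewrite !inE.
Qed.

Lemma codegree_count H x y : is_3graph H -> x != y ->
  codegree H x y = #|[set z | [set x; y; z] \in H]|.
Proof.
move=> H3 xy; rewrite /codegree.
rewrite -(@card_in_imset _ _ (fun z => [set x; y; z])).
  apply: eq_card => e; rewrite inE; apply/andP/imsetP => [[eH xye]|[z]].
    have /eqP := H3 _ eH; rewrite -(cardsID [set x; y]) (setIidPr xye) cards2 xy /=.
    rewrite -[3]/(2 + 1) eqn_add2l => /cards1P[z ez].
    have eE : e = [set x; y; z] by rewrite -ez -{1}(setID e [set x; y]) (setIidPr xye).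
    by exists z; rewrite // inE -eE.
  by rewrite inE => ? ->; split=> //; apply: subsetUl.
move=> z t; rewrite !inE => /H3/eqP; rewrite cards3 => /and3P[_ yz xz] _ zt.
have : z \in [set x; y; t] by rewrite -zt !inE eqxx orbT.
by rewrite !inE eq_sym (negPf xz) eq_sym (negPf yz) => /eqP.
Qed.

(** The bound [k <= #|T|] covers the default value of the iterated minimum. *)
Lemma delta2_ge H k : k <= #|T| ->
  (forall x y, x != y -> k <= codegree H x y) -> k <= delta2 H.
Proof.
move=> kT kH; rewrite /delta2; apply: (big_ind (fun m => k <= m)) => //.
  by move=> a b ka kb; rewrite leq_min ka.
by move=> [x y] /= /kH.
Qed.

Lemma codegree_subU3 (H0 H F C : {set {set T}}) x y : H0 \subset H :|: (F :|: C) ->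
  codegree H0 x y <= codegree H x y + (codegree F x y + codegree C x y).
Proof.
move=> sH; rewrite /codegree.
apply: (@leq_trans #|[set e in H | [set x; y] \subset e] :|:
  ([set e in F | [set x; y] \subset e] :|: [set e in C | [set x; y] \subset e])|).
  apply: subset_leq_card; apply/subsetP => e; rewrite !inE => /andP[/(subsetP sH)].
  by rewrite !inE => /or3P[] -> ->; rewrite ?orbT.
by apply: (leq_trans (leq_card_setU _ _)); rewrite leq_add2l leq_card_setU.
Qed.

(** The general target lets one identity serve for degrees, edge counts and weights in Z/3. *)
Lemma sum_setD2 (R : nmodType) (H0 F C : {set {set T}}) (g : {set T} -> R) :
    F \subset H0 -> C \subset H0 -> [disjoint F & C] ->
  (\sum_(e in H0) g e =
     \sum_(e in H0 :\: (F :|: C)) g e + (\sum_(e in F) g e + \sum_(e in C) g e))%R.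
Proof.
move=> sF sC dFC; have sFC : F :|: C \subset H0 by rewrite subUset sF.
rewrite (big_setID (F :|: C)) /= (setIidPr sFC) addrC; congr (_ + _)%R.
by rewrite -bigU //; apply: eq_bigl => e; rewrite !inE.
Qed.

(** * Indexed families of triples *)

Section Family.
Variables (J : finType) (u : J -> T) (sg ta : J -> J).

(** Common form of the gadget and the tight cycle: [u] places abstract indices as vertices, while
    [sg] and [ta] carry the combinatorics. *)
Definition triple j := [set u j; u (sg j); u (ta j)].
Definition triples := [set triple j | j : J].

Hypotheses (sgI : injective sg) (taI : injective ta).
Hypotheses (tripleI : injective triple) (triple3 : forall j, #|triple j| = 3).

(* Each vertex occurs equally often as first, second and third vertex of a triple. *)
Lemma dvdn_degree_triples x : 3 %| degree triples x.
Proof.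
rewrite degree_sum /triples big_imset /=; last by move=> j k _ _; apply: tripleI.
have -> : \sum_j (x \in triple j : nat) =
    \sum_j (x == u j : nat) + \sum_j (x == u (sg j) : nat) + \sum_j (x == u (ta j) : nat).
  rewrite -!big_split; apply: eq_bigr => j _ /=; rewrite !inE.
  have /eqP := triple3 j; rewrite cards3 => /and3P[uv vw uw].
  case: (eqVneq x (u j)) => [->|_] /=; first by rewrite (negPf uv) (negPf uw).
  by case: (eqVneq x (u (sg j))) => [->|_] //=; rewrite (negPf vw).
have reindexE (h : J -> J) : injective h ->
    \sum_j (x == u (h j) : nat) = \sum_j (x == u j : nat).
  by move=> hI; rewrite [RHS](reindex_inj hI).
by rewrite !reindexE //; apply/dvdnP; exists (\sum_j (x == u j : nat)); lia.
Qed.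

Lemma card_triples : #|triples| = #|J|.
Proof. by rewrite card_imset. Qed.

End Family.

Lemma codegree_triples (J : finType) (u : J -> T) (sg ta : J -> J) x y :
  codegree (triples u sg ta) x y <= #|[set j | [set x; y] \subset triple u sg ta j]|.
Proof.
apply: leq_trans (leq_imset_card (triple u sg ta) _); apply: subset_leq_card.
apply/subsetP => e; rewrite inE => /andP[/imsetP[j _ ->] xye].
by apply: imset_f; rewrite inE.
Qed.

End Triples.

(** * The weight in Z/3 and its vanishing on tours *)

Section Labels.
Variables (T : finType) (lab : T -> 'I_3).
Implicit Types (x y z : T) (e : {set T}) (a b c : 'I_3).

Definition lcount e c := #|[set x in e | lab x == c]|.

Definition two_labelled : {set {set T}} :=
  [set e : {set T} | (#|e| == 3) && [exists c, lcount e c == 2]].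

Definition count_weight (p q : nat) : 'Z_3 :=
  (if (p == 2) && (q == 1) then 1 else if (p == 1) && (q == 2) then -1 else 0)%R.

Definition weight e : 'Z_3 := count_weight (lcount e 0%R) (lcount e 1%R).

Definition potential a b : 'Z_3 :=
  (if (a == 0) && (b == 1) then 1 else if (a == 1) && (b == 0) then -1 else 0)%R.

Lemma two_labelled_3graph : is_3graph two_labelled.
Proof. by move=> e; rewrite inE => /andP[/eqP]. Qed.

Lemma lcount3 x y z c : #|[set x; y; z]| = 3 ->
  lcount [set x; y; z] c = (lab x == c) + (lab y == c) + (lab z == c).
Proof.
move=> /eqP; rewrite cards3 => /and3P[xy yz xz].
rewrite /lcount -(big_set3 addn (fun t => lab t == c : nat) xy yz xz).
rewrite -sum1_card big_mkcond [RHS]big_mkcond.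
by apply: eq_bigr => t _; rewrite !inE; do !case: (_ == _).
Qed.

(** Among three labels 0, 1 or 3 pairs agree; exactly one agreeing pair means exactly two
    classes. *)
Lemma two_labelled3 x y z : #|[set x; y; z]| = 3 ->
  ([set x; y; z] \in two_labelled) =
  ((lab x == lab y) + (lab y == lab z) + (lab x == lab z) == 1).
Proof.
move=> e3; rewrite inE e3 eqxx /=.
transitivity ((lcount [set x; y; z] (lab x) == 2) || (lcount [set x; y; z] (lab y) == 2)).
  apply/existsP/orP => [[c]|[]]; last 2 first; [by exists (lab x)|by exists (lab y)|].
  rewrite !lcount3 //.
  move: (lab x) (lab y) (lab z) => a b d; rewrite -!val_eqE /=.
  by case: a b d c => [[|[|[|?]]] ?] [[|[|[|?]]] ?] [[|[|[|?]]] ?] [[|[|[|?]]] ?] //=; auto.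
rewrite !lcount3 //; move: (lab x) (lab y) (lab z) => a b d; rewrite -!val_eqE /=.
by case: a b d => [[|[|[|?]]] ?] [[|[|[|?]]] ?] [[|[|[|?]]] ?].
Qed.

(** The potential f is antisymmetric. Label patterns aab and baa give f(a,b) at once; aba gives
    f(b,a) - f(a,b) = -2f(a,b), which is f(a,b) only because the modulus is 3. *)
Lemma weight3 x y z : [set x; y; z] \in two_labelled ->
  (weight [set x; y; z] = potential (lab y) (lab z) - potential (lab x) (lab y))%R.
Proof.
move=> eH; have e3 := two_labelled_3graph eH.
move: eH; rewrite two_labelled3 // /weight !lcount3 //.
move: (lab x) (lab y) (lab z) => a b d; rewrite /potential -!val_eqE /=.
by case: a b d => [[|[|[|?]]] ?] [[|[|[|?]]] ?] [[|[|[|?]]] ?] //= _; apply/eqP.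
Qed.

(* The weight of an edge is the increment of the potential along it, so it telescopes to 0. *)
Lemma sum_weight_closed (J : finType) (sg : J -> J) (u : J -> T) :
    injective sg -> (forall j, triple u sg (sg \o sg) j \in two_labelled) ->
  (\sum_j weight (triple u sg (sg \o sg) j) = 0)%R.
Proof.
move=> sgI eH.
rewrite (eq_bigr _ (fun j _ => weight3 (eH j))).
rewrite sumrB; apply/eqP; rewrite subr_eq0; apply/eqP.
by rewrite [RHS](reindex_inj sgI).
Qed.

Lemma sum_weight_tour (H : {set {set T}}) s : H \subset two_labelled -> is_tour H s ->
  (\sum_(e in tour_edges s) weight e = 0)%R.
Proof.
move=> /subsetP sH [_ eH eI]; rewrite big_imset /=; last by move=> i j _ _; apply: eI.
by apply: (@sum_weight_closed _ (@ordS _)) => [|j]; [apply: ordS_inj|apply/sH/eH].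
Qed.

Lemma sum_weight_tour_decomposition (H : {set {set T}}) D :
  H \subset two_labelled -> tour_decomposition H D -> (\sum_(e in H) weight e = 0)%R.
Proof.
move=> sH [tD disjD coverD].
(* Describing the edges through [D] alone allows induction on [D]; disjointness then splits off one
   tour at a time. *)
rewrite (eq_bigl (fun e => has (fun s => e \in tour_edges s) D)); last first.
  move=> e; apply/idP/hasP => [/coverD[s]|[s /tD[_ eH _] /imsetP[i _ ->]]] //.
  by exists s.
elim: D tD disjD {coverD} => [|s D IH] tD /=; first by rewrite big_pred0.
case/andP=> /allP dsD disjD; rewrite (bigID (fun e => e \in tour_edges s)) /=.
have sD t : t \in D -> is_tour H t by move=> tD'; apply: tD; rewrite inE tD' orbT.
rewrite (eq_bigl (mem (tour_edges s))); last first.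
  by move=> e; rewrite andb_orl andbb orb_idr // => /andP[].
rewrite (sum_weight_tour sH (tD s _)) ?inE ?eqxx // add0r -[RHS](IH sD disjD).
apply: eq_bigl => e; rewrite andb_orl andbN /=; apply: andb_idr => /hasP[t tD' et].
by rewrite (disjointFl (dsD t tD') et).
Qed.

(** The involution exchanging classes 0 and 1 permutes the edges and negates weights, so S = -S, and
    2 is invertible mod 3. *)
Lemma sum_weight_two_labelled (sw : T -> T) :
    involutive sw -> (forall x, lab (sw x) = tperm 0%R 1%R (lab x)) ->
  (\sum_(e in two_labelled) weight e = 0)%R.
Proof.
move=> swK lab_sw.
have lcount_sw e c : lcount (sw @: e) c = lcount e (tperm 0%R 1%R c).
  rewrite /lcount -[RHS](card_imset _ (inv_inj swK)); apply: eq_card => x.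
  rewrite !inE; apply/andP/imsetP.
    case=> /imsetP[y ye ->]; rewrite lab_sw => /eqP cE.
    by exists y; rewrite // inE ye -cE tpermK eqxx.
  case=> y; rewrite inE => /andP[ye /eqP yc] ->.
  by rewrite imset_f // lab_sw yc tpermK eqxx.
set S := (\sum_(e in _) _)%R.
have SN : S = (- S)%R.
  rewrite {1}/S (reindex_inj (imset_inj (inv_inj swK))) /S -sumrN.
  apply: eq_big => [e|e _].
    rewrite !inE card_imset; last exact: inv_inj.
    congr (_ && _); apply/existsP/existsP => [[c cE]|[c cE]].
      by exists (tperm 0%R 1%R c); rewrite -lcount_sw.
    by exists (tperm 0%R 1%R c); rewrite lcount_sw tpermK.
  rewrite /weight !lcount_sw tpermL tpermR.
  by move: (lcount _ _) (lcount _ _) => [|[|[|p]]] [|[|[|q]]]; apply/eqP.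
by case: S SN => [[|[|[|?]]] i] /eqP // _; apply/eqP.
Qed.

End Labels.

(** * Transfer of triples along an injective placement *)

Lemma triple_imset (J T : finType) (u : J -> T) sg ta j :
  triple u sg ta j = u @: triple id sg ta j.
Proof. by rewrite /triple !imsetU !imset_set1. Qed.

Lemma triple_inj (J T : finType) (u : J -> T) (sg ta : J -> J) : injective u ->
  injective (triple id sg ta) -> injective (triple u sg ta).
Proof. by move=> uI tI j k; rewrite !(triple_imset u) => /(imset_inj uI)/tI. Qed.

Lemma card_triple (J T : finType) (u : J -> T) (sg ta : J -> J) : injective u ->
  (forall j, #|triple id sg ta j| = 3) -> forall j, #|triple u sg ta j| = 3.
Proof. by move=> uI t3 j; rewrite triple_imset card_imset. Qed.

Lemma codegree_triples_le (J T : finType) (u : J -> T) (sg ta : J -> J) m :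
    injective u ->
    (forall a b, a != b -> #|[set j | [set a; b] \subset triple id sg ta j]| <= m) ->
  forall x y, x != y -> codegree (triples u sg ta) x y <= m.
Proof.
move=> uI codm x y xy; apply: leq_trans (codegree_triples _ _ _ _ _) _.
case: (set_0Vmem [set j | [set x; y] \subset triple u sg ta j]) => [->|[j]].
  by rewrite cards0.
rewrite inE triple_imset subUset !sub1set => /andP[/imsetP[a _ xa] /imsetP[b _ yb]].
have ab : a != b by apply: contraNneq xy => ab; rewrite xa yb ab.
apply: leq_trans (codm a b ab); apply: subset_leq_card; apply/subsetP => k.
rewrite !inE triple_imset !subUset !sub1set xa yb.
by rewrite !mem_imset.
Qed.

Lemma iter_ordS_neq n (i : 'I_n) m : 0 < m < n -> iter m (@ordS n) i != i.
Proof.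
case/andP=> m0 mn; have iterE : iter m (@ordS n) i = (i + m) %% n :> nat.
  elim: m {m0 mn} => [|m IH] /=; first by rewrite addn0 modn_small.
  by rewrite IH addnS -(addn1 (_ %% _)) modnDml addn1.
rewrite -val_eqE /= iterE -[X in _ != X](modn_small (ltn_ord i)).
by rewrite -[X in _ != X %% n]addn0 eqn_modDl mod0n modn_small // -lt0n.
Qed.

(** * Windows of three consecutive indices modulo L *)

Section TightCycle.
Variable L : nat.
Hypothesis L_ge4 : 4 <= L.
Local Notation S := (@ordS L).
Implicit Types i j p a b : 'I_L.

Lemma ordS_neqs i : [/\ S i != i, S (S i) != i & S (S (S i)) != i].
Proof.
split; [apply: (iter_ordS_neq i (m := 1))|apply: (iter_ordS_neq i (m := 2))|
        apply: (iter_ordS_neq i (m := 3))]; lia.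
Qed.

Lemma card_window j : #|triple id S (S \o S) j| = 3.
Proof.
have [n1 n2 _] := ordS_neqs j; have [n3 _ _] := ordS_neqs (S j).
by apply/eqP; rewrite cards3 /= eq_sym n1 eq_sym n3 eq_sym n2.
Qed.

(** If the windows at j and k agree, j lies in the window at k. Were j the first or second successor
    of k, the window at j would contain the third successor of k, which is outside the window at k
    since L >= 4. *)
Lemma window_inj : injective (triple id S (S \o S)).
Proof.
move=> j k jk; have [n1 n2 n3] := ordS_neqs k.
have S3 : S (S (S k)) \notin triple id S (S \o S) k.
  by rewrite !inE /= (negPf n3) !(inj_eq (@ordS_inj L)) (negPf n2) (negPf n1).
have : j \in triple id S (S \o S) k by rewrite -jk !inE eqxx.
rewrite !inE /= => /orP[/orP[/eqP //|]|] /eqP jE; case/negP: S3; rewrite -jk jE.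
  by rewrite !inE /= eqxx !orbT.
by rewrite !inE /= eqxx !orbT.
Qed.

(** Only the windows starting at p, p+1 and p+2 contain a = p+2, so it is enough that b misses one
    of them: b = p misses the second and b = p+1 the third. *)
Lemma codegree_window a b : a != b ->
  #|[set j | [set a; b] \subset triple id S (S \o S) j]| <= 2.
Proof.
move=> ab; set D := [set j | _]; set p := ord_pred (ord_pred a).
have aE : a = S (S p) by rewrite /p !ord_predK.
have DE j : (j \in D) = (a \in triple id S (S \o S) j) && (b \in triple id S (S \o S) j).
  by rewrite inE subUset !sub1set.
rewrite -ltnS -(card_window p); apply: proper_card; rewrite properE; apply/andP; split.
  apply/subsetP => j; rewrite DE aE => /andP[+ _]; rewrite !inE /= !(inj_eq (@ordS_inj L)).
  by case/orP => [/orP[]|] /eqP <-; rewrite eqxx ?orbT.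
apply/negP => /subsetP sD.
have bw j : j \in triple id S (S \o S) p -> b \in triple id S (S \o S) j.
  by move=> /sD; rewrite DE => /andP[].
have [n1 n2 n3] := ordS_neqs p; move: bw ab; rewrite aE => bw ab.
have /orP : (b == p) || (b == S p).
  by have := bw p; rewrite !inE /= eqxx [b == S (S p)]eq_sym (negPf ab) orbF; apply.
case=> /eqP bE.
  have := bw (S p); rewrite bE !inE /= eqxx orbT => /(_ isT).
  by rewrite ![p == _]eq_sym (negPf n1) (negPf n2) (negPf n3).
have := bw (S (S p)); rewrite bE !inE /= eqxx !orbT => /(_ isT).
by rewrite !(inj_eq (@ordS_inj L)) ![p == _]eq_sym (negPf n1) (negPf n2) (negPf n3).
Qed.

End TightCycle.

(** * The abstract gadget on Z/3 x Z/4 *)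

Section Gadget.
Local Notation sg := (fun p : 'I_3 * 'I_4 => (p.1, ordS p.2)).
Local Notation ta := (fun p : 'I_3 * 'I_4 => (ordS p.1, p.2)).

Lemma gadget_card p : #|triple id sg ta p| = 3.
Proof.
by apply/eqP; rewrite cards3; case: p => [[[|[|[|?]]] ?] [[|[|[|[|?]]]] ?]].
Qed.

(** The six differences within a triple, namely (0,1), (1,0), (1,-1) and their negatives, are
    distinct in Z/3 x Z/4, so a pair determines its triple. *)
Lemma gadget_codegree a b : a != b -> #|[set j | [set a; b] \subset triple id sg ta j]| <= 1.
Proof.
move=> ab; apply/card_le1_eqP => j k; rewrite !inE !subUset !sub1set !inE.
case/andP=> aj bj kab; apply/eqP; move: aj bj ab kab; case: j k => [c i] [d k].
have c3 := ltn_ord c; have d3 := ltn_ord d; have i4 := ltn_ord i; have k4 := ltn_ord k.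
do 2![case/orP => [/orP[]|] /eqP ->] => {a b} //; rewrite !xpair_eqE -!val_eqE /=.
all: lia.
Qed.

End Gadget.

(** * The host 3-graph on three classes of size N *)

Section Construction.
Variables (T : finType) (N : nat) (lab : T -> 'I_3) (idx : T -> nat).
(** Inverse of the coordinates ([lab], [idx]), meaningful only for positions below N. *)
Variable vtx : 'I_3 -> nat -> T.
Hypothesis lab_vtx : forall c i, i < N -> lab (vtx c i) = c.
Hypothesis idx_vtx : forall c i, i < N -> idx (vtx c i) = i.
Hypothesis idx_lt : forall x, idx x < N.
Hypothesis vtxK : forall x, vtx (lab x) (idx x) = x.
Local Notation H0 := (two_labelled lab).
Implicit Types (x y z : T) (c : 'I_3).

Lemma vtx_inj c d i j : i < N -> j < N -> vtx c i = vtx d j -> c = d /\ i = j.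
Proof.
move=> iN jN e; split; first by rewrite -(lab_vtx c iN) e lab_vtx.
by rewrite -(idx_vtx c iN) e idx_vtx.
Qed.

Lemma sum_lab c : \sum_x (lab x == c : nat) = N.
Proof.
rewrite -big_mkcond sum1dep_card -[RHS]card_ord.
rewrite -(card_imset _ (f := fun i : 'I_N => vtx c i)); last first.
  by move=> i j /(vtx_inj (ltn_ord i) (ltn_ord j)) [_ /val_inj].
apply: eq_card => x; rewrite inE; apply/eqP/imsetP => [<-|[i _ ->]].
  by exists (Ordinal (idx_lt x)); rewrite ?vtxK.
exact: lab_vtx.
Qed.

Lemma card_T : #|T| = 3 * N.
Proof.
rewrite -sum1_card (eq_bigr (fun x => \sum_c (lab x == c : nat))).
  by rewrite exchange_big /= (eq_bigr _ (fun c _ => sum_lab c)) sum_nat_const card_ord.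
by move=> x _; rewrite (bigD1 (lab x)) //= eqxx big1 // => c /negPf; rewrite eq_sym => ->.
Qed.

(** Within one class, the third vertex is any of the 2N outside it; across two classes, it is any
    other vertex of those two. *)
Lemma codegree_two_labelled x y : x != y ->
  codegree H0 x y = 2 * (N - (lab x != lab y)).
Proof.
move=> xy; rewrite codegree_count //; last exact: two_labelled_3graph.
rewrite -sum1_card big_mkcond /=.
have zE z : (z \in [set z | [set x; y; z] \in H0]) =
  [&& z != x, z != y & (lab x == lab y) + (lab y == lab z) + (lab x == lab z) == 1].
  rewrite inE; have := cards3 x y z; rewrite xy /= [z == x]eq_sym [z == y]eq_sym.
  case: (boolP ((y != z) && (x != z))) => [/andP[yz xz] /eqP e3|yxz e3].
    by rewrite two_labelled3 // yz xz.
  rewrite inE e3 /=; apply/esym/negbTE; apply: contra yxz.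
  by case/and3P=> -> ->.
have sum1x t : \sum_z (z == t : nat) = 1.
  by rewrite (bigD1 t) //= eqxx big1 // => z /negPf ->.
set s := \sum_z _.
case: (eqVneq (lab x) (lab y)) => [lxy|lxy] /=.
  suff : s + \sum_z (lab z == lab x : nat) = \sum_(z : T) 1.
    by rewrite sum_lab sum1_card card_T; lia.
  rewrite -big_split; apply: eq_bigr => z _ /=; rewrite zE lxy eqxx.
  rewrite [lab y == _]eq_sym; case: (eqVneq z x) => [->|_] /=; first by rewrite lxy eqxx.
  by case: (eqVneq z y) => [->|_] /=; rewrite ?eqxx //; case: (lab z == _).
suff : s + (\sum_z (z == x : nat) + \sum_z (z == y : nat)) =
       \sum_z (lab z == lab x : nat) + \sum_z (lab z == lab y : nat).
  by rewrite !sum_lab !sum1x; lia.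
rewrite -!big_split; apply: eq_bigr => z _ /=; rewrite zE (negPf lxy).
rewrite [lab y == _]eq_sym [lab x == _]eq_sym.
case: (eqVneq z x) => [->|_] /=; first by rewrite (negPf xy) eqxx (negPf lxy).
case: (eqVneq z y) => [->|_] /=; first by rewrite eqxx eq_sym (negPf lxy).
case: (eqVneq (lab z) (lab x)) => [->|_]; first by rewrite (negPf lxy).
by case: (lab z == _).
Qed.

(** Summing codegrees gives 2(N-1)(3N-1) + 2(N-1) = 6N(N-1), twice the degree, so the degree is
    3N(N-1). *)
Lemma dvdn_degree_two_labelled x : 3 %| degree H0 x.
Proof.
have := sum_codegree x (@two_labelled_3graph _ lab).
have -> : \sum_(y | y != x) codegree H0 x y =
          \sum_(y | y != x) (2 * (N - 1) + 2 * (lab y == lab x)).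
  apply: eq_bigr => y yx; rewrite codegree_two_labelled 1?eq_sym // eq_sym.
  by have := idx_lt x; case: (lab y == lab x) => /=; lia.
have := sum_lab (lab x); rewrite (bigD1 x) //= eqxx => sl.
rewrite big_split /= sum_nat_const -big_distrr /=.
have -> : #|[pred y | y != x]| = 3 * N - 1.
  by rewrite subn1 -card_T -(cardC1 x).
have N_gt0 : 0 < N by apply: leq_ltn_trans (idx_lt x).
move=> d2; apply/dvdnP; exists (N * (N - 1)).
move: sl d2; set s := \sum_(i | _) _ => sl.
have {sl}-> : s = N - 1 by rewrite -sl; lia.
nia.
Qed.

Definition swap_labels x := vtx (tperm 0%R 1%R (lab x)) (idx x).

Lemma sum_weight_H0 : (\sum_(e in H0) weight lab e = 0)%R.
Proof.
apply: (@sum_weight_two_labelled _ _ swap_labels) => x; last by rewrite lab_vtx.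
by rewrite /swap_labels lab_vtx // idx_vtx // tpermK vtxK.
Qed.

(* Four edges with two vertices in class c and one in class c + 1, for each c mod 3. The third
   class cannot be avoided: degrees divisible by 3 force the analogues of [weight] for the
   pairs of classes (0, 1), (1, 2) and (2, 0) to have the same total mod 3. *)
Definition gadget_vtx (p : 'I_3 * 'I_4) := vtx p.1 p.2.
Local Notation sg := (fun p : 'I_3 * 'I_4 => (p.1, ordS p.2)).
Local Notation ta := (fun p : 'I_3 * 'I_4 => (ordS p.1, p.2)).
Definition gadget := triples gadget_vtx sg ta.

(** * The gadget inside the host *)

Section Gadget.
Hypothesis N_ge4 : 4 <= N.

Let ltN (i : 'I_4) : i < N.
Proof. exact: leq_trans (ltn_ord i) N_ge4. Qed.

Lemma gadget_vtx_inj : injective gadget_vtx.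
Proof.
by move=> [c i] [d j] /(vtx_inj (ltN i) (ltN j)) /= [-> /val_inj ->].
Qed.

Lemma gadget_triple_inj : injective (triple gadget_vtx sg ta).
Proof.
apply: triple_inj gadget_vtx_inj _ => p q pq.
have p_sp : p != (p.1, ordS p.2).
  by case: p {pq} => c i; rewrite xpair_eqE eqxx eq_sym (iter_ordS_neq i (m := 1)).
(* Equal triples share a pair of distinct indices, so codegree at most 1 identifies them. *)
have /card_le1_eqP := gadget_codegree p_sp.
by apply; rewrite inE subUset !sub1set -?pq !inE !eqxx orbT.
Qed.

Lemma codegree_gadget x y : x != y -> codegree gadget x y <= 1.
Proof. exact: codegree_triples_le gadget_vtx_inj gadget_codegree _ _. Qed.

Lemma dvdn_degree_gadget x : 3 %| degree gadget x.
Proof.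
apply: dvdn_degree_triples gadget_triple_inj _ _.
- by move=> [c i] [d j] e; congr pair; [have := congr1 fst e|have /ordS_inj := congr1 snd e].
- by move=> [c i] [d j] e; congr pair; [have /ordS_inj := congr1 fst e|have := congr1 snd e].
exact: card_triple gadget_vtx_inj gadget_card.
Qed.

Lemma card_gadget : #|gadget| = 12.
Proof. by rewrite card_triples ?card_prod ?card_ord //; apply: gadget_triple_inj. Qed.

Lemma gadget_two_labelled p : triple gadget_vtx sg ta p \in H0.
Proof.
rewrite two_labelled3; last exact: (card_triple gadget_vtx_inj gadget_card p).
have /negPf n : p.1 != ordS p.1 by rewrite eq_sym;
  apply: (iter_ordS_neq p.1 (m := 1)).
rewrite !lab_vtx; try exact: ltN.
by rewrite eqxx n.
Qed.

Lemma sub_gadget : gadget \subset H0.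
Proof. by apply/subsetP => _ /imsetP[p _ ->]; apply: gadget_two_labelled. Qed.

(** Only the four edges with c = 0 have nonzero weight, each weight 1, and 4 = 1 mod 3. *)
Lemma sum_weight_gadget : (\sum_(e in gadget) weight lab e = 1)%R.
Proof.
rewrite big_imset /=; last by move=> p q _ _; apply: gadget_triple_inj.
rewrite (eq_bigr _ (fun p _ => weight3 (gadget_two_labelled p))).
rewrite (eq_bigr (fun p => potential p.1 (ordS p.1) - potential p.1 p.1)%R); last first.
  by move=> p _; rewrite !lab_vtx.
rewrite -(pair_bigA _ (fun c (i : 'I_4) => potential c (ordS c) - potential c c)%R) /=.
rewrite (eq_bigr (fun c => (potential c (ordS c) - potential c c) *+ 4)%R); last first.
  by move=> c _; rewrite sumr_const card_ord.
by rewrite !big_ord_recl big_ord0; apply/eqP.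
Qed.

End Gadget.

(* Labels alternate between 0 and 1 along the cycle; only its vertices with j./2 = N - 4
   can meet the gadget. *)
Definition cycle_vtx L (j : 'I_L) := vtx (inord (odd j)) (N.-1 - j./2).
Definition cycle L := triples (@cycle_vtx L) (@ordS L) (@ordS L \o @ordS L).

(** * The tight cycle inside the host *)

Section Cycle.
Variable L : nat.
Hypotheses (L_ge4 : 4 <= L) (LN : L <= 2 * (N - 3)).
Local Notation S := (@ordS L).

Let ltN (j : 'I_L) : N.-1 - j./2 < N.
Proof. by have := ltn_ord j; lia. Qed.

Lemma cycle_vtx_inj : injective (@cycle_vtx L).
Proof.
move=> i j /(vtx_inj (ltN i) (ltN j)) [/(congr1 val)].
rewrite /= !inordK; try by case: odd.
move=> oij hij; apply: val_inj => /=.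
rewrite -(odd_double_half i) -(odd_double_half j) oij; congr (_ + _.*2).
by have := ltn_ord i; have := ltn_ord j; lia.
Qed.

Lemma cycle_triple_inj : injective (triple (@cycle_vtx L) S (S \o S)).
Proof. exact: triple_inj cycle_vtx_inj (window_inj L_ge4). Qed.

Lemma codegree_cycle x y : x != y -> codegree (cycle L) x y <= 2.
Proof. exact: codegree_triples_le cycle_vtx_inj (codegree_window L_ge4) _ _. Qed.

Lemma dvdn_degree_cycle x : 3 %| degree (cycle L) x.
Proof.
apply: dvdn_degree_triples; [exact: ordS_inj| |exact: cycle_triple_inj|].
  by apply: inj_comp; apply: ordS_inj.
exact: card_triple cycle_vtx_inj (card_window L_ge4).
Qed.

Lemma card_cycle : #|cycle L| = L.
Proof. by rewrite card_triples ?card_ord //; apply: cycle_triple_inj. Qed.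

(** Only labels 0 and 1 occur and never three times in a row. For odd L the wrap-around repeats
    label 0 just once, which is harmless. *)
Lemma cycle_two_labelled j : triple (@cycle_vtx L) S (S \o S) j \in H0.
Proof.
rewrite two_labelled3; last exact: (card_triple cycle_vtx_inj (card_window L_ge4) j).
have SE (k : 'I_L) : S k = (if k.+1 < L then k.+1 else 0) :> nat.
  rewrite /=; case: ifP => kL; first exact: modn_small.
  have -> : k.+1 = L by have := ltn_ord k; lia.
  exact: modnn.
have labE (b1 b2 : bool) : (inord b1 == inord b2 :> 'I_3) = (b1 == b2).
  by rewrite -val_eqE /= !inordK; case: b1 b2 => [] [].
rewrite !lab_vtx // !labE.
rewrite /comp !SE; case: ifP => [_|jL]; case: ifP => [_|jL2] /=; try by case: odd.
by move: jL2; lia.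
Qed.

Lemma sub_cycle : cycle L \subset H0.
Proof. by apply/subsetP => _ /imsetP[p _ ->]; apply: cycle_two_labelled. Qed.

Lemma sum_weight_cycle : (\sum_(e in cycle L) weight lab e = 0)%R.
Proof.
rewrite big_imset /=; last by move=> p q _ _; apply: cycle_triple_inj.
by apply: sum_weight_closed cycle_two_labelled; apply: ordS_inj.
Qed.

(** Cycle vertices have position at least 3, while a gadget edge contains two cyclically consecutive
    positions modulo 4, at most one of which is 3. *)
Lemma disjoint_gadget_cycle : [disjoint gadget & cycle L].
Proof.
rewrite -setI_eq0; apply/eqP/setP => e; rewrite !inE; apply/negbTE/negP.
case/andP=> /imsetP[p _ ->] /imsetP[j _ pj].
have idx_ge3 x : x \in triple (@cycle_vtx L) S (S \o S) j -> 3 <= idx x.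
  rewrite triple_imset => /imsetP[k _ ->]; rewrite idx_vtx //.
  by have := ltn_ord k; lia.
have := idx_ge3 (gadget_vtx p); have := idx_ge3 (gadget_vtx (p.1, ordS p.2)).
rewrite -pj !inE !eqxx orbT => /(_ isT) + /(_ isT).
have N4 : 4 <= N by move: L_ge4 LN; lia.
rewrite !idx_vtx; try exact: leq_trans (ltn_ord _) N4.
by case: p.2 => [[|[|[|[|?]]]] ?].
Qed.

End Cycle.

(** * Removing the gadget and the cycle *)

Lemma counterexample l : 4 <= l -> l + 3 <= N ->
  exists H : {set {set T}},
    [/\ is_3graph H, Cl_divisible l H, 2 * N - 5 <= delta2 H
      & ~ exists D : seq (seq T), tour_decomposition H D].
Proof.
move=> l4 lN; have N4 : 4 <= N by lia.
(* The residue makes the number of remaining edges divisible by l; the extra l gives L >= 4, and L <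
   2l <= 2(N-3). *)
pose L := l + (#|H0| - 12) %% l.
have mod_lt : (#|H0| - 12) %% l < l by rewrite ltn_mod; lia.
have L4 : 4 <= L by lia.
have LN : L <= 2 * (N - 3) by lia.
have sF := sub_gadget N4; have sC := sub_cycle L4 LN.
have dFC := disjoint_gadget_cycle L4 LN.
pose H := H0 :\: (gadget :|: cycle L).
have sH : H \subset H0 by apply: subsetDl.
exists H; split.
- by move=> e /(subsetP sH)/two_labelled_3graph.
- split=> [x|].
    have := sum_setD2 (fun e : {set T} => x \in e : nat) sF sC dFC.
    rewrite -!degree_sum => dE; have := dvdn_degree_two_labelled x.
    by rewrite dE dvdn_addl // dvdn_add ?dvdn_degree_gadget ?dvdn_degree_cycle.
  have := sum_setD2 (fun=> 1) sF sC dFC.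
  rewrite !sum1_card card_gadget // card_cycle // => cE.
  have : #|H0| - 12 = #|H| + L by rewrite cE -/H /GRing.add /=; lia.
  move=> HE; have := divn_eq (#|H0| - 12) l.
  rewrite {1}HE /L => dE; apply/dvdnP; exists ((#|H0| - 12) %/ l - 1).
  by rewrite mulnBl mul1n; lia.
- apply: delta2_ge => [|x y xy]; first by rewrite card_T; lia.
  have : H0 \subset H :|: (gadget :|: cycle L).
    by apply/subsetP => e eH; rewrite in_setU in_setD eH andbT orNb.
  move=> /(codegree_subU3 x y); rewrite codegree_two_labelled //.
  have := codegree_gadget N4 xy; have := codegree_cycle L4 LN xy.
  (* The extreme case is a pair across classes: 2(N-1) - 1 - 2 = 2N - 5. *)
  by case: (lab x == lab y) => /=; lia.
(* A tour decomposition would turn the weight identity into 0 = 0 + (1 + 0) in Z/3. *)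
case=> D tD; have := sum_setD2 (weight lab) sF sC dFC.
rewrite sum_weight_H0 sum_weight_gadget // sum_weight_cycle //.
by rewrite (sum_weight_tour_decomposition sH tD) add0r addr0 => /eqP.
Qed.

End Construction.

(** * Realization on the vertex set ['I_n] *)

Theorem theorem1p4 (l n : nat) (hl : 4 <= l) (hn : 3 * (l + 3) <= n)
    (hn18 : 18 %| n) :
  exists H : {set {set 'I_n}},
    [/\ is_3graph H,
        Cl_divisible l H,
        ((2 * n%:R - 15) / 3 <= (delta2 H)%:R :> rat)%R
      & ~ exists D : seq (seq 'I_n), tour_decomposition H D].
Proof.
have [N nE] : exists N, n = 3 * N by exists (n %/ 3); move: hn18 => /dvdnP[k ->]; lia.
have lN : l + 3 <= N by lia.
(* [inord] needs an ordinal type of successor form. *)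
have [n' n'E] : exists n', n = n'.+1 by exists n.-1; lia.
move: hn hn18 nE; rewrite {n}n'E => hn hn18 nE.
(* Classes are residues mod 3 and positions are quotients by 3. *)
have [||||H [H3 Hdiv Hdeg Htour]] := @counterexample 'I_n'.+1 N (fun x => inord (x %% 3))
  (fun x => x %/ 3) (fun c i => inord (i * 3 + c)) _ _ _ _ l hl lN.
- move=> c i iN; apply: val_inj; have c3 := ltn_ord c.
  by rewrite /= [X in X %% 3]inordK ?modnMDl ?modn_small ?inordK //; lia.
- by move=> c i iN; have c3 := ltn_ord c; rewrite inordK; lia.
- by move=> x; have := ltn_ord x; lia.
- by move=> x; rewrite inordK ?ltn_pmod // -divn_eq inord_val.
exists H; split=> //.
rewrite ler_pdivrMr // lerBlDr -!natrM -natrD ler_nat.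
lia.
Qed.
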